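(* Let $k_1,k_2$ be positive integers, not both equal to $1$. Let $C(k_1,k_2)$ denote the union of two internally disjoint directed paths, one of length $k_1$ and one of length $k_2$, with the same initial vertex $a$ and the same terminal vertex $b$. Let $\vec H^*$ denote the digraph obtained from $C(k_1,k_2)$ by adding arcs from $a$ to every vertex other than $b$ (and other than $a$ itself). Then every digraph with minimum out-degree at least $k_1+k_2-1=|V(\vec H^* )|-1$ contains a subdivision of $\vec H^*$.
   Context: All digraphs are finite, nonempty and simple: no loops and no two distinct arcs with the same tail and the same head (two arcs with opposite directions between the same pair of vertices are allowed); in particular an arc is added only if not already present. A digraph contains a subdivision of $\vec F$ if it has a subdigraph isomorphic to a digraph obtained from $\vec F$ by replacing each arc $(u,v)$ by a directed path from $u$ to $v$ of length at least one, these paths being internally disjoint from each other and from $V(\vec F)$. *)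

(* Defs.v *)
From mathcomp Require Import all_boot.

Set Implicit Arguments.
Unset Strict Implicit.
Unset Printing Implicit Defensive.

Record digraph := Digraph {
  vertex :> finType;
  arc : rel vertex;
  arc_irr : irreflexive arc;
  vertex_gt0 : 0 < #|vertex|
}.

Definition outdeg (D : digraph) (x : D) : nat := #|[set y | arc x y]|.

(* (x, y) is an arc of the directed path visiting the vertices of p in order *)
Definition path_arc (T : eqType) (p : seq T) : rel T :=
  fun x y => infix [:: x; y] p.

(* P u v lists the internal vertices of the directed path that replaces the
   arc (u, v); its values at pairs that are not arcs of F are irrelevant. *)
Definition full_path (F S : digraph) (b : F -> S) (P : F -> F -> seq S)
  (u v : F) : seq S := b u :: rcons (P u v) (b v).

Definition is_subdivision (F S : digraph) : Prop :=
  exists (b : F -> S) (P : F -> F -> seq S),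
  [/\ injective b,
      forall u v, arc u v ->
        uniq (P u v) /\ (forall w, b w \notin P u v),
      forall u v u' v', arc u v -> arc u' v' -> (u, v) <> (u', v') ->
        forall x, ~ (x \in P u v /\ x \in P u' v'),
      forall x : S, (exists w, x = b w) \/
        (exists u v, arc u v /\ x \in P u v)
    & forall x y : S, arc x y <->
        exists u v, arc u v /\ path_arc (full_path b P u v) x y].

Definition has_subdigraph_iso_to (D S : digraph) : Prop :=
  exists g : S -> D,
    injective g /\ (forall x y, arc x y -> arc (g x) (g y)).

Definition contains_subdivision (D F : digraph) : Prop :=
  exists S : digraph, is_subdivision F S /\ has_subdigraph_iso_to D S.

(* Model of C(k1, k2) on {0, ..., k1 + k2 - 1} with a = 0 and b = k1: the path
   of length k1 is 0, 1, ..., k1 and the path of length k2 is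
   0, k1 + 1, ..., k1 + k2 - 1, k1. *)
Definition path1 (k1 : nat) : seq nat := iota 0 k1.+1.
Definition path2 (k1 k2 : nat) : seq nat :=
  0 :: rcons (iota k1.+1 k2.-1) k1.

Definition C_arc (k1 k2 : nat) : rel 'I_(k1 + k2) :=
  fun u v => path_arc (path1 k1) (val u) (val v)
          || path_arc (path2 k1 k2) (val u) (val v).

Lemma path_arc_irr (T : eqType) (p : seq T) : uniq p -> irreflexive (path_arc p).
Proof.
move=> up x; apply/negP => /infixW /subseq_uniq /(_ up).
by rewrite /= inE eqxx.
Qed.

Lemma C_arc_irr (k1 k2 : nat) : 0 < k1 -> irreflexive (@C_arc k1 k2).
Proof.
move=> k1_gt0 u; rewrite /C_arc !path_arc_irr ?iota_uniq //.
rewrite /path2 /= rcons_uniq iota_uniq mem_rcons inE !mem_iota ltnn /= !andbT.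
by rewrite orbF eq_sym -lt0n.
Qed.

Lemma C_vertex_gt0 (k1 k2 : nat) : 0 < k1 -> 0 < #|'I_(k1 + k2)|.
Proof. by move=> k1_gt0; rewrite card_ord addn_gt0 k1_gt0. Qed.

Definition C (k1 k2 : nat) (hk1 : 0 < k1) : digraph :=
  Digraph (C_arc_irr (k2 := k2) hk1) (C_vertex_gt0 k2 hk1).
Arguments C k1 k2 hk1 : clear implicits.

Definition Hstar_arc (k1 k2 : nat) (hk1 : 0 < k1) : rel (C k1 k2 hk1) :=
  fun u v => arc u v || [&& val u == 0, val v != 0 & val v != k1].

Lemma Hstar_arc_irr (k1 k2 : nat) (hk1 : 0 < k1) :
  irreflexive (@Hstar_arc k1 k2 hk1).
Proof.
by move=> u; rewrite /Hstar_arc arc_irr /=; case: (val u == 0).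
Qed.

Definition Hstar (k1 k2 : nat) (hk1 : 0 < k1) : digraph :=
  Digraph (@Hstar_arc_irr k1 k2 hk1) (vertex_gt0 (C k1 k2 hk1)).
Arguments Hstar k1 k2 hk1 : clear implicits.

(* Main.v *)
Require Import Defs.
From mathcomp Require Import all_boot.
From mathcomp Require Import zify.

(** If [k1 = 1] or [k2 = 1], take a longest path: all out-neighbours of its end
    [a] lie on it, so a segment of it is a leg dominated by [a].

    Otherwise put [i = k1 - 1] and [j = k2]. In a minimal nonempty set [A] with at
    most one out-neighbour outside choose an arc from [c] to [g] through which [A]
    sees nothing new, and colour vertices of [A] one at a time with the colour of
    [c] or of [g]. Each new vertex has, up to truncation at [i] (resp. [j]), at
    least as many out-neighbours among the older vertices of its colour as every
    vertex coloured later or never. The colouring can be steered so that an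
    uncoloured vertex [a] gets [i] out-neighbours of the first colour and [j] of
    the second: as long as no vertex exceeds these bounds, one either colours a
    vertex of maximal degree or, if this would cut a set [B] off the other colour,
    colours everything but [B] with that other colour and goes on inside [B].

    Inside one colour, tokens placed on the out-neighbours of [a] are pushed down
    to the root, always moving the most recent one; the greedy condition leaves
    enough room to let them join one by one a single path to the root. This gives
    the two legs, ending in [c] and in [g], and [b] is [g]. *)

Set Implicit Arguments.
Unset Strict Implicit.
Unset Printing Implicit Defensive.

(** * Greedy colourings *)

Section Coloring.

Variables (V : finType) (e : rel V).
Implicit Types (s C Q R : seq V) (T X B Z : {set V}) (t u w x y : V).

(* A leg lists its hits [(Q, y, R)]: [Q] is the inner part of the path from the
   apex to the hit [y], and [R] follows [y] on the spine up to the next hit. *)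
Definition leg := seq (seq V * V * seq V).
Implicit Type L : leg.

Definition leg_vertices L := flatten [seq h.1.1 ++ h.1.2 :: h.2 | h <- L].
Definition leg_spine L := flatten [seq h.1.2 :: h.2 | h <- L].
Definition leg_starts L := [seq head h.1.2 h.1.1 | h <- L].
Definition leg_fans L := all (fun h => sorted e (rcons h.1.1 h.1.2)) L.

Definition deg s u := count (e u) s.

(* [s] has its most recent element first. *)
Fixpoint greedy i T s : Prop :=
  if s is t :: s' then
    [/\ forall u, u \in T -> minn (deg s' u) i <= deg s' t,
        s' = [::] \/ 0 < deg s' t
      & greedy i (t |: T) s']
  else True.

Lemma greedy_sub i T T' s : T' \subset T -> greedy i T s -> greedy i T' s.
Proof.
elim: s T T' => //= t s IHs T T' sTT' [Hdeg Hpos Hg]; split=> //.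
  by move=> u /(subsetP sTT'); apply: Hdeg.
by apply: IHs Hg; apply: setUS.
Qed.

Lemma greedy_split i T s1 t s2 : greedy i T (s1 ++ t :: s2) ->
  (forall u, (u \in T) || (u \in s1) -> minn (deg s2 u) i <= deg s2 t)
  /\ (s2 = [::] \/ 0 < deg s2 t).
Proof.
elim: s1 T => [|h s1 IHs] T /=.
  by case=> Hdeg Hpos _; split=> // u; rewrite orbF; apply: Hdeg.
case=> _ _ /IHs[Hdeg Hpos]; split=> // u Hu; apply: Hdeg.
by move: Hu; rewrite !inE; case: (u == h); rewrite ?orbT.
Qed.

(** Suffixes of [s] are nested, so avoiding the longest one singled out by [P] avoids all of
    them. *)
Lemma largest_split (P : V -> seq V -> bool) s :
  exists s1 s2, [/\ s = s1 ++ s2,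
    s2 = [::] \/ (exists s1' t, s1 = rcons s1' t /\ P t s2)
    & forall s1' t s2', s = s1' ++ t :: s2' -> P t s2' -> {subset s2' <= s2}].
Proof.
elim: s => [|h s [s1 [s2 [-> Hs2 Hmax]]]].
  by exists [::], [::]; split; [|left|case].
case Ph: (P h (s1 ++ s2)).
  exists [:: h], (s1 ++ s2); split=> //; first by right; exists [::], h.
  move=> s1' t s2' Es _ x xs2'; case: s1' Es => [|h' s1'] [_ ->] //.
  by rewrite mem_cat inE xs2' !orbT.
exists (h :: s1), s2; split=> //.
  case: Hs2 => [|[s1' [t [-> Pt]]]]; first by left.
  by right; exists (h :: s1'), t.
move=> s1' t s2' Es Pt; case: s1' Es => [|h' s1'] [Eh Es].
  by rewrite -Eh -Es Ph in Pt.
exact: Hmax Es Pt.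
Qed.

(** * Tokens moving down one colour, and the legs they trace *)

Lemma count_mem_card X s : uniq s -> {subset X <= s} -> count [in X] s = #|X|.
Proof.
move=> Us sXs; rewrite -size_filter cardE; apply/perm_size/uniq_perm.
- exact: filter_uniq.
- exact: enum_uniq.
by move=> x; rewrite mem_filter mem_enum andb_idr //; apply: sXs.
Qed.


Lemma perm_enumD1 X x : x \in X -> perm_eq (enum X) (x :: enum (X :\ x)).
Proof.
move=> xX; apply: uniq_perm; rewrite /= ?enum_uniq ?mem_enum ?setD11 //.
by move=> y; rewrite inE !mem_enum !inE; case: eqP => [->|].
Qed.

Lemma perm_enumU1 X x : x \notin X -> perm_eq (enum (x |: X)) (x :: enum X).
Proof. by move=> xX; rewrite -{2}(setU1K xX) perm_enumD1 ?setU11. Qed.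

(* The active token [w] traces the spine; every other token of [X] has to hit
   the spine, each at a different vertex. [Q] is the trace of a possible hit at
   [w] itself, which is forbidden when [sat] holds. The highest token is moved
   first, so that traces can only meet at tokens. *)
Lemma token_game i T s X w (sat : bool) r :
    uniq s -> greedy i T s -> last w s = r ->
    {subset X <= s} -> w \in X -> #|X| <= i ->
    (forall s1 t s2, s = s1 ++ t :: s2 -> deg s2 t + 2 <= #|X| ->
      count [in X] s2 <= deg s2 t /\ w \notin s2) ->
    (sat -> forall s1 t s2, s = s1 ++ t :: s2 -> w \in s2 -> #|X| <= deg s2 t) ->
  exists Q R L,
    [/\ [/\ sorted e (w :: R ++ leg_spine L), last w (R ++ leg_spine L) = r,
            leg_fans L, sorted e (rcons Q w) & sat -> Q = [::]],
        uniq (Q ++ w :: R ++ leg_vertices L),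
        {subset Q ++ w :: R ++ leg_vertices L <= s}
      & perm_eq (w :: take 1 Q ++ leg_starts L) (enum X)].
Proof.
elim: s T X w sat => [|h s IHs] T X w sat /=; first by move=> _ _ _ sX /sX.
case/andP=> hs Us [_ Hpos Hg] Hlast sXs wX leXi Hbar Hsat.
have Hbar' s1 t s2 : s = s1 ++ t :: s2 -> deg s2 t + 2 <= #|X| ->
    count [in X] s2 <= deg s2 t /\ w \notin s2.
  by move=> Es; apply: (Hbar (h :: s1)); rewrite Es.
have Hsat' : sat -> forall s1 t s2, s = s1 ++ t :: s2 -> w \in s2 ->
    #|X| <= deg s2 t.
  by move=> Ha s1 t s2 Es; apply: (Hsat Ha (h :: s1)); rewrite Es.
have Hl z : z \in s -> last z s = r by case: (s) Hlast.
case: (boolP (h \in X)) => [hX | hX]; last first.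
  have sX' : {subset X <= s}.
    move=> x xX; have := sXs x xX; rewrite inE => /predU1P[Ex|//].
    by rewrite -Ex xX in hX.
  have [Q [R [L [H1 H2 H3 H4]]]] :=
    IHs _ _ _ _ Us Hg (Hl w (sX' w wX)) sX' wX leXi Hbar' Hsat'.
  by exists Q, R, L; split=> // x /H3 xs; apply: mem_behead.
set Y := X :\ h.
have cX : #|X| = #|Y|.+1 by rewrite (cardsD1 h X) hX.
have leYX : #|Y| <= #|X| by rewrite cX.
have pX : perm_eq (enum X) (h :: enum Y) := perm_enumD1 hX.
have sYs : {subset Y <= s}.
  by move=> x; rewrite !inE => /andP[xh /sXs]; rewrite inE (negPf xh).
have cY s2 : count [in Y] s2 <= count [in X] s2.
  by apply: sub_count => x; rewrite !inE => /andP[].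
have cXs : count [in X] s = #|Y|.
  have := count_mem_card (s := h :: s) (X := X).
  by rewrite /= hs hX cX => H; have := H Us sXs; lia.
have fresh l : uniq l -> {subset l <= s} ->
    uniq (h :: l) /\ {subset h :: l <= h :: s}.
  move=> Ul sls; split; first by rewrite /= Ul andbT (contra (sls h)).
  move=> x; rewrite inE => /predU1P[->|/sls xs]; first exact: mem_head.
  exact: mem_behead.
(* A smaller degree would put all of [s] under the bound [Hbar], although [s] contains every token
   but the one at [h]. *)
have dh : #|Y| <= deg s h.
  case: (leqP (deg s h + 2) #|X|) => [le2|]; last by lia.
  by have [] := Hbar [::] h s erefl le2; rewrite cXs; lia.
(* Since [deg s2 t] is below [#|X| <= i], the truncation at [i] is inactive. *)
have degh s1 t s2 : s = s1 ++ t :: s2 -> deg s2 t + 2 <= #|X| ->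
    deg s2 h <= deg s2 t.
  move=> Es le2; move: Hg; rewrite Es => /greedy_split[/(_ h)].
  by rewrite !inE eqxx /= => /(_ isT); lia.
have movedP z : z \in s -> z \notin X ->
  [/\ {subset z |: Y <= s}, #|z |: Y| = #|X|,
      perm_eq (enum (z |: Y)) (z :: enum Y)
    & forall s2, z \notin s2 -> count [in z |: Y] s2 <= count [in X] s2].
  move=> zs zX; have zY : z \notin Y by rewrite !inE (negPf zX) andbF.
  split; [|by rewrite cardsU1 zY cX|exact: perm_enumU1|].
    by move=> x; rewrite in_setU1 => /predU1P[->|/sYs].
  move=> s2 zs2; rewrite (leq_trans _ (cY s2)) // -!size_filter.
  rewrite (@eq_in_filter _ _ [in Y]) // => x xs2; rewrite /= in_setU1.
  by case: eqP xs2 zs2 => [->->|].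
have [wh | wh] := eqVneq w h.
  subst w.
  have [s0|sn0] := eqVneq s [::].
    subst s; exists [::], [::], [::]; split=> //=.
    rewrite perm_sym (permPl pX) perm_cons.
    by move/esym/eqP: cXs; rewrite /= cards_eq0 => /eqP->; rewrite enum_set0.
  (* The active token must stay out of every suffix [s2] preceded by some [t] with
     [deg s2 t + 2 <= #|X|]. The degree of [h] is at least [#|X| - 1] in [s] but smaller in the
     largest such suffix, so some out-neighbour [z] lies in [u]. *)
  have [u [s2 [Es Hs2 Hmax]]] :=
    largest_split (fun t s2 => deg s2 t + 2 <= #|X|) s.
  have [z hz zu]: exists2 z, e h z & z \in u.
    have : 0 < deg u h.
      have Ed : deg s h = deg u h + deg s2 h by rewrite Es /deg count_cat.
      case: Hs2 => [E|[s1' [t [Eu le2]]]].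
        by case: Hpos => [E0|]; [rewrite E0 in sn0 | rewrite Ed E addn0].
      have Es' : s = s1' ++ t :: s2 by rewrite Es Eu cat_rcons.
      by move: Ed dh cX (le2) (degh _ _ _ Es' le2); clear; lia.
    by rewrite -has_count => /hasP[z zu hz]; exists z.
  have zs : z \in s by rewrite Es mem_cat zu.
  have zout s1 t s2' : s = s1 ++ t :: s2' -> deg s2' t + 2 <= #|X| ->
      z \notin s2'.
    move=> Es' le2; apply/negP => /(Hmax _ _ _ Es' le2) zs2.
    by move: Us; rewrite Es cat_uniq => /and3P[_ /hasPn/(_ z zs2)]; rewrite /= zu.
  have zh : z != h by apply: contraNneq hs => <-.
  (* If [z] carries a token, the spine hits it; the loss of one token gives the slack that [sat]
     demands. Otherwise the active token moves to [z], where a hit is still allowed. *)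
  case: (boolP (z \in X)) => zX.
    have zY : z \in Y by rewrite !inE zh.
    have [|||Q [R [L [[H1 H2 H3 H4 H5] H6 H7 H8]]]] :=
        IHs _ _ _ true Us Hg (Hl z zs) sYs zY.
    - exact: leq_trans leYX leXi.
    - move=> s1 t s2' Es' /leq_trans/(_ leYX) le2.
      split; last exact: zout Es' le2.
      by have [le3 _] := Hbar' _ _ _ Es' le2; apply: leq_trans (cY _) le3.
    - move=> _ s1 t s2' Es'; apply: contraLR; rewrite -ltnNge => lt.
      by apply: zout Es' _; rewrite cX addn2.
    rewrite (H5 isT) in H6 H7 H8; have [U2 S2] := fresh _ H6 H7.
    exists [::], [::], (([::], z, R) :: L); split; [|exact: U2|exact: S2|].
      by split=> //=; rewrite hz.
    by rewrite perm_sym (permPl pX) perm_cons perm_sym.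
  have [D1 D2 D4 D3] := movedP z zs zX.
  have zX' : z \in z |: Y by rewrite !inE eqxx.
  have [|||Q [R [L [[H1 H2 H3 H4 _] H6 H7 H8]]]] :=
      IHs _ _ _ false Us Hg (Hl z zs) D1 zX'.
  - by rewrite D2.
  - move=> s1 t s2' Es'; rewrite D2 => le2; split; last exact: zout Es' _.
    have [+ _] := Hbar' _ _ _ Es' le2; apply: leq_trans.
    exact: D3 (zout _ _ _ Es' le2).
  - by [].
  have H8' : perm_eq (h :: take 1 Q ++ leg_starts L) (enum X).
    move: H8; rewrite (permPr D4) perm_cons => H8.
    by rewrite (permPr pX) perm_cons.
  have [U2 S2] := fresh _ H6 H7; exists [::].
  case: Q H4 U2 S2 H8' {H6 H7 H8} => [|q Q] H4 U2 S2 H8'.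
    exists (z :: R), L; split; [|exact: U2|exact: S2|exact: H8'].
    by split=> //=; rewrite hz.
  have E : (q :: Q) ++ z :: R ++ leg_vertices L
         = leg_vertices ((q :: Q, z, R) :: L).
    by rewrite /leg_vertices /= -!catA.
  rewrite {}E in U2 S2.
  exists [::], ((q :: Q, z, R) :: L); split; [|exact: U2|exact: S2|].
    by split=> //=; rewrite ?hz //; apply/andP.
  by move: H8'; rewrite /= take0.
have wY : w \in Y by rewrite !inE wh.
have ws : w \in s := sYs w wY.
(* The token at [h] is not the active one. A suffix that already holds as many tokens as [Hbar]
   permits cannot receive another; [u] is what precedes the largest such suffix. *)
have [u [s2 [Es Hs2 Hmax]]] := largest_split
  (fun t s2 => (deg s2 t + 2 <= #|X|) && (count [in X] s2 == deg s2 t)) s.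
have wu : w \in u.
  case: Hs2 => [E|[s1' [t [Eu /andP[le2 _]]]]].
    by move: ws; rewrite Es E cats0.
  have Es' : s = s1' ++ t :: s2 by rewrite Es Eu cat_rcons.
  have [_ ws2] := Hbar' _ _ _ Es' le2.
  by move: ws; rewrite Es Eu mem_cat (negPf ws2) orbF.
have us2 : {in u, forall x, x \notin s2}.
  move=> x xu; apply/negP => xs2; move: Us.
  by rewrite Es cat_uniq => /and3P[_ /hasPn/(_ x xs2)]; rewrite /= xu.
have su : {subset u <= s} by move=> x xu; rewrite Es mem_cat xu.
have degu : count [in X] u + deg s h <= deg u h + #|Y|.
  have Ed : deg s h = deg u h + deg s2 h by rewrite Es /deg count_cat.
  have Ec : count [in X] u + count [in X] s2 = #|Y|.
    by rewrite -cXs Es count_cat.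
  case: Hs2 => [E|[s1' [t [Eu /andP[le2 /eqP E]]]]].
    by rewrite Ed -Ec E /deg /= !addn0 addnC.
  have Es' : s = s1' ++ t :: s2 by rewrite Es Eu cat_rcons.
  by move: Ed Ec E (degh _ _ _ Es' le2); clear; lia.
case: (boolP (has [pred z | e h z & z \notin X] u)) => [/hasP[z zu]|].
  case/andP=> hz zX; have zs := su z zu; have [D1 D2 D4 D3] := movedP z zs zX.
  have wX' : w \in z |: Y by rewrite in_setU1 wY orbT.
  have [|||Q [R [L [[H1 H2 H3 H4 H5] H6 H7 H8]]]] :=
      IHs _ _ _ sat Us Hg (Hl w ws) D1 wX'.
  - by rewrite D2.
  - move=> s1 t s2' Es'; rewrite D2 => le2.
    have [le3 ws2] := Hbar' _ _ _ Es' le2; split=> //.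
    case: (boolP (z \in s2')) => [zs2'|/D3 le4]; last exact: leq_trans le4 le3.
    have lt : count [in X] s2' < deg s2' t.
      rewrite ltn_neqAle le3 andbT; apply/negP => E.
      have /= := Hmax _ _ _ Es'; rewrite le2 => /(_ E z zs2').
      by apply/negP; apply: us2.
    apply: leq_trans lt; rewrite -add1n.
    apply: leq_trans (_ : count (pred1 z) s2' + count [in Y] s2' <= _).
      rewrite -count_predUI; apply: leq_trans (leq_addr _ _).
      by apply: sub_count => x; rewrite /= in_setU1.
    apply: leq_add (cY _); rewrite count_uniq_mem ?leq_b1 //.
    by move: Us; rewrite Es' cat_uniq => /and3P[_ _ /andP[]].
  - by rewrite D2.
  have zw : z != w by apply: contraNneq zX => ->.
  (* The token at [z] starts either the trace [Q] or a hit of [L]; [h] is prepended there. *)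
  have : z \in w :: take 1 Q ++ leg_starts L.
    by rewrite (perm_mem H8) mem_enum !inE eqxx.
  rewrite inE (negPf zw) /= mem_cat => /orP[zQ|zL].
    case: Q zQ H4 H5 H6 H7 H8 => [//|q Q] zQ H4 H5 H6 H7 H8.
    have {zQ}Eq : z = q by move: zQ; rewrite /= take0 inE => /eqP.
    subst q; have [U2 S2] := fresh _ H6 H7.
    exists (h :: z :: Q), R, L; split; [|exact: U2|exact: S2|].
      by split=> //=; rewrite ?hz //; move/H5.
    rewrite (permPr pX); move: H8; rewrite (permPr D4) /= take0 /=.
    by move=> /permP H; apply/permP => p; have := H p; clear; rewrite /=; lia.
  case/mapP: zL => -[[Q1 y] R1] /splitPr[L1 L2] /= Ez in H1 H2 H3 H6 H7 H8 *.
  exists Q, R, (L1 ++ (h :: Q1, y, R1) :: L2).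
  have ES : leg_spine (L1 ++ (h :: Q1, y, R1) :: L2)
          = leg_spine (L1 ++ (Q1, y, R1) :: L2).
    by rewrite /leg_spine !map_cat.
  have EV : perm_eq (Q ++ w :: R ++ leg_vertices (L1 ++ (h :: Q1, y, R1) :: L2))
              (h :: Q ++ w :: R ++ leg_vertices (L1 ++ (Q1, y, R1) :: L2)).
    apply/permP => p; rewrite /leg_vertices !map_cat !flatten_cat /=.
    rewrite !(count_cat, cat_cons) /= !(count_cat, cat_cons) /= !count_cat /=.
    by clear; lia.
  have [U2 S2] := fresh _ H6 H7.
  split.
  - rewrite ES; split=> //; move: H3; rewrite /leg_fans !all_cat /=.
    case/and3P=> -> H3 ->; rewrite andbT /=.
    by move: hz H3; rewrite Ez; clear; case: Q1 => [|q Q1] /= ->.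
  - by rewrite (perm_uniq EV).
  - by move=> x; rewrite (perm_mem EV); apply: S2.
  rewrite (permPr pX); move: H8; rewrite (permPr D4) /leg_starts !map_cat /= -Ez.
  move=> /permP H; apply/permP => p; have := H p.
  by clear; rewrite /= !count_cat /=; lia.
(* Without a free out-neighbour in [u], counting by [degu] and [dh] shows that the out-neighbours of
   [h] in [u] are exactly the tokens there, including the active one. So the token at [h] hits the
   spine at [w]. *)
move/hasPn=> Hall.
have Hu : {in u, forall z, e h z -> z \in X}.
  by move=> z /Hall /=; rewrite negb_and negbK => /orP[/negPf->|->].
have degX : deg u h <= count [in X] u.
  rewrite /deg -!size_filter; set f := filter _ u.
  have -> : f = filter (e h) (filter [in X] u).
    rewrite -filter_predI; apply: eq_in_filter => z zu /=.
    by case: (e h z) (Hu z zu) => //= ->.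
  exact/size_subseq/filter_subseq.
have hw : e h w.
  have Euh : count [in X] u <= deg u h by move: degu dh; clear; lia.
  have /hasPn/(_ w wu) : ~~ has [pred z | (z \in X) && ~~ e h z] u.
    rewrite has_count -leqNgt.
    have := count_predC (e h) (filter [in X] u).
    rewrite !count_filter size_filter.
    have -> : count (predI (e h) [in X]) u = deg u h.
      apply: eq_in_count => z zu /=.
      by case: (e h z) (Hu z zu) => //= ->.
    have -> : count (predI (predC (e h)) [in X]) u
            = count [pred z | (z \in X) && ~~ e h z] u.
      by apply: eq_count => z /=; rewrite andbC.
    by move: Euh degX; clear; lia.
  by rewrite /= wX negbK.
(* If [sat] held, [h] would have at least [#|X|] out-neighbours in [s], hence by [degu] more of them
   in [u] than there are tokens, against [degX]. *)
have satF : sat = false.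
  by apply/negP=> Ha; move: degX degu cX (Hsat Ha [::] h s erefl ws); clear; lia.
have [|||Q [R [L [[H1 H2 H3 H4 H5] H6 H7 H8]]]] :=
    IHs _ _ _ true Us Hg (Hl w ws) sYs wY.
- exact: leq_trans leYX leXi.
- move=> s1 t s2' Es' /leq_trans/(_ leYX) le2.
  have [le3 ws2] := Hbar' _ _ _ Es' le2.
  by split=> //; apply: leq_trans le3.
- move=> _ s1 t s2' Es'; apply: contraLR; rewrite -ltnNge => lt.
  by have [|_] := Hbar' _ _ _ Es'; first by rewrite cX addn2.
rewrite (H5 isT) in H6 H7 H8; have [U2 S2] := fresh _ H6 H7.
exists [:: h], R, L; split; [|exact: U2|exact: S2|].
  by split=> //=; rewrite ?hw // satF.
rewrite (permPr pX); move: H8 => /permP H; apply/permP => p.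
by have := H p; clear; rewrite /=; lia.
Qed.

(** Tokens on [n] out-neighbours of [a] satisfy the invariant of [token_game]: where
    [deg s2 t + 2 <= n], greediness bounds [deg s2 a] by [deg s2 t]. The active token is chosen
    outside all suffixes of this kind. *)
Lemma caterpillar n i T s a :
    uniq s -> greedy i T s -> a \in T -> 0 < n <= i -> n <= deg s a ->
  exists L,
    [/\ size L = n, sorted e (leg_spine L) /\ leg_fans L,
        last a (leg_spine L) = last a s, uniq (leg_vertices L)
      & {subset leg_vertices L <= s} /\ all (e a) (leg_starts L)].
Proof.
move=> Us Hg aT /andP[n_gt0 leni] lens.
pose f := take n (filter (e a) s); pose X := [set x in f].
have Uf : uniq f by rewrite take_uniq ?filter_uniq.
have cX : #|X| = n.
  by rewrite cardsE (card_uniqP Uf) size_take_min size_filter; apply/minn_idPl.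
have Xa x : x \in X -> e a x && (x \in s).
  by rewrite inE => /mem_take; rewrite mem_filter.
have sXs : {subset X <= s} by move=> x /Xa/andP[].
have bar s1 t s2 : s = s1 ++ t :: s2 -> deg s2 t + 2 <= #|X| ->
    count [in X] s2 <= deg s2 t.
  move=> Es; rewrite cX => le2; move: Hg; rewrite Es => /greedy_split[/(_ a)].
  rewrite aT => /(_ isT) dega _.
  apply: (@leq_trans (deg s2 a)); first by apply: sub_count => x /Xa/andP[].
  by move: dega le2 leni; clear; lia.
have [u [s2 [Es Hs2 Hmax]]] :=
  largest_split (fun t s2 => deg s2 t + 2 <= #|X|) s.
have [w wu wX] : exists2 w, w \in u & w \in X.
  have : 0 < count [in X] u.
    have := count_mem_card Us sXs; rewrite cX {1}Es count_cat.
    case: Hs2 => [->|[s1' [t [Eu le2]]]]; first by rewrite addn0 => ->.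
    have := bar s1' t s2; rewrite Es Eu cat_rcons => /(_ erefl le2).
    by move: le2 n_gt0; rewrite cX; clear; lia.
  by rewrite -has_count => /hasP[w wu wX]; exists w.
have us2 : w \notin s2.
  apply/negP => ws2; move: Us.
  by rewrite Es cat_uniq => /and3P[_ /hasPn/(_ w ws2)]; rewrite /= wu.
have ws : w \in s := sXs w wX.
have Hl : last w s = last a s by case: (s) ws.
have [||//|Q [R [L [[H1 H2 H3 H4 _] H5 H6 H7]]]] :=
    token_game (sat := false) Us Hg Hl sXs wX.
- by rewrite cX.
- move=> s1 t s2' Es' le2; split; first exact: bar Es' le2.
  by apply: contra us2; exact: (Hmax _ _ _ Es' le2 w).
have sz := perm_size H7; rewrite -cardE cX in sz.
have starts x : x \in w :: take 1 Q ++ leg_starts L -> e a x.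
  by rewrite (perm_mem H7) mem_enum => /Xa/andP[].
(* A nonempty trace [q :: Q] leads into [w], so it can open the spine: [q] becomes the first hit and
   [w] the second. *)
case: Q H4 H5 H6 H7 sz starts => [|q Q] H4 H5 H6 H7 sz starts.
  exists (([::], w, R) :: L); split=> //.
  - by rewrite -sz /= size_map.
  by split=> //; apply/allP => x; apply: starts.
exists (([::], q, Q) :: ([::], w, R) :: L); split=> //.
- by rewrite -sz /= take0 /= size_map.
- split=> //; rewrite /leg_spine /= -/(leg_spine L).
  move: H1 H4; rewrite /= rcons_path => H1 /andP[HQ Hw].
  by rewrite cat_path HQ /= Hw.
- by rewrite -H2 /leg_spine /= !last_cat /= !last_cat.
split=> //; apply/allP => x xin; apply: starts.
by move: xin; rewrite /= take0 !inE orbCA.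
Qed.

(** * Two-colourings and the sets they cut off *)

Definition stuck B C :=
  [forall x in B, forall y, e x y ==> (y \in B) || (y \in C)].

Lemma stuckP B C :
  reflect (forall x y, x \in B -> e x y -> (y \in B) || (y \in C)) (stuck B C).
Proof.
apply: (iffP forall_inP) => [H x y xB exy | H x xB].
  by have /forallP/(_ y)/implyP/(_ exy) := H x xB.
by apply/forallP => y; apply/implyP; apply: H.
Qed.

(* A partial two-colouring: [sc] and [sg] list the vertices of the two colours,
   the most recent first, with roots [c] and [g]; [T] is the uncoloured part. *)
Record coloring i j c g sc sg T : Prop := Coloring {
  col_uniq : uniq (sc ++ sg);
  col_out : forall t, t \in T -> t \notin sc ++ sg;
  col_all : stuck T (sc ++ sg);
  col_rootc : exists s, sc = rcons s c;
  col_rootg : exists s, sg = rcons s g;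
  col_greedyc : greedy i T sc;
  col_greedyg : greedy j T sg;
  col_escc : forall B, B != set0 -> B \subset T -> ~~ stuck B sg;
  col_escg : forall B, B != set0 -> B \subset T -> ~~ stuck B sc;
  col_gate : forall B x, B != set0 -> B \subset T -> ~~ stuck B [:: x]
}.

Lemma stuck_eq B C C' : C =i C' -> stuck B C = stuck B C'.
Proof.
by move=> E; apply: eq_forallb => x; congr (_ ==> _); apply: eq_forallb => y;
  rewrite E.
Qed.

Lemma coloring_swap i j c g sc sg T :
  coloring i j c g sc sg T -> coloring j i g c sg sc T.
Proof.
case=> H1 H2 H3 H4 H5 H6 H7 H8 H9 H10; split=> //.
- by rewrite uniq_catC.
- by move=> t /H2; rewrite !mem_cat orbC.
- by rewrite (@stuck_eq _ _ (sc ++ sg)) // => x; rewrite !mem_cat orbC.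
Qed.

Definition bounded n s T := forall t, t \in T -> deg s t <= n.

(** These sets would lose access to the other colour if [r] joined [sc]. They are closed under
    union, so [maxbad] is the largest. *)
Definition bad (sc : seq V) T r B := (B \subset T :\ r) && stuck B (r :: sc).

Definition maxbad (sc : seq V) T r := \bigcup_(B | bad sc T r B) B.

Lemma maxbad_bad sc T r : bad sc T r (maxbad sc T r).
Proof.
apply/andP; split; first by apply/bigcupsP => B /andP[].
apply/stuckP => x y /bigcupP[B HB xB] exy.
have /andP[_ /stuckP/(_ x y xB exy)/orP[yB|->]] := HB; last exact: orbT.
by apply/orP; left; apply/bigcupP; exists B.
Qed.

Lemma maxbad_sup sc T r B : bad sc T r B -> B \subset maxbad sc T r.
Proof. exact: bigcup_sup. Qed.

(** The last two hypotheses provide greediness. The condition at risk is [col_escg], and a set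
    violating it would be a nonempty bad set. *)
Lemma color_safe i j c g sc sg T t :
    coloring i j c g sc sg T -> t \in T -> maxbad sc T t = set0 ->
    (forall u, u \in T -> minn (deg sc u) i <= deg sc t) -> 0 < deg sc t ->
  coloring i j c g (t :: sc) sg (T :\ t).
Proof.
case=> H1 H2 H3 [s Es] H5 H6 H7 H8 H9 H10 tT mb0 degT deg_gt0.
have sT : T :\ t \subset T := subsetDl _ _.
split=> //.
- by rewrite cat_cons cons_uniq H1 H2.
- by move=> u; rewrite !inE => /andP[/negPf-> /H2].
- apply/stuckP => x y; rewrite !inE => /andP[_ xT] exy.
  have /stuckP/(_ x y xT exy) := H3.
  by case: (y == t); rewrite //= ?orbT.
- by exists (t :: s); rewrite Es.
- split; last by rewrite setD1K.
  + by move=> u /(subsetP sT); apply: degT.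
  + by right.
- exact: greedy_sub H7.
- by move=> B B0 sB; apply: H8 B0 (subset_trans sB sT).
- move=> B B0 sB; apply/negP => HB.
  have: bad sc T t B by apply/andP.
  by move/maxbad_sup; rewrite mb0 subset0 (negPf B0).
by move=> B x B0 sB; apply: H10 B0 (subset_trans sB sT).
Qed.

(* Colouring by decreasing degree is greedy; the last hypothesis bounds by 1 the
   degree of the remaining vertices [T]. *)
Lemma color_all j T Z sg g :
    uniq sg -> (exists s, sg = rcons s g) -> greedy j (Z :|: T) sg ->
    {in Z, forall z, z \notin sg} ->
    (forall B, B != set0 -> B \subset Z ->
      exists x y, [/\ x \in B, e x y, y \notin B & (y \in Z) || (y \in sg)]) ->
    (forall t y y', t \in T -> e t y -> e t y' ->
      (y \in Z) || (y \in sg) -> (y' \in Z) || (y' \in sg) -> y = y') ->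
  exists s, [/\ uniq s, exists s', s = rcons s' g, greedy j T s
              & s =i [predU Z & mem sg]].
Proof.
have [m leZm] := ubnP #|Z|; elim: m Z sg leZm => // m IHm Z sg leZm Us Hr Hg Zsg.
have [-> | Z0] := eqVneq Z set0.
  move=> _ _; exists sg; split=> //; last by move=> x; rewrite !inE.
  by apply: greedy_sub Hg; apply: subsetUr.
move=> Hesc Hone; have [z0 z0Z] := set0Pn _ Z0.
(* Maximality handles the vertices of [Z]. Those of [T] have degree at most 1, while [z] has
   positive degree because [Z] is not cut off from [sg]. *)
pose z := [arg max_(z > z0 in Z) deg sg z].
have [zZ zmax] : z \in Z /\ forall u, u \in Z -> deg sg u <= deg sg z.
  by rewrite /z; case: arg_maxnP.
have degz : 0 < deg sg z.
  have [x [y [xZ exy yZ]]] := Hesc Z Z0 (subxx Z).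
  rewrite (negPf yZ) => ysg; apply: leq_trans (zmax x xZ).
  by rewrite -has_count; apply/hasP; exists y.
have degT u : u \in T -> deg sg u <= 1.
  move=> uT; rewrite /deg -size_filter.
  have : uniq (filter (e u) sg) by apply: filter_uniq.
  have : all (fun y => e u y && (y \in sg)) (filter (e u) sg).
    by apply/allP => y; rewrite mem_filter.
  case: (filter _ _) => [|y [|y' s]] //= /and3P[/andP[uy yi] /andP[uy' yi'] _].
  by rewrite (Hone u y y') ?yi ?yi' ?orbT // inE eqxx.
have EZ : z |: (Z :\ z :|: T) = Z :|: T by rewrite setUA setD1K.
have Emem y : (y \in Z :\ z) || (y \in z :: sg) = (y \in Z) || (y \in sg).
  by rewrite !inE; case: eqP => [->|]; rewrite ?zZ.
have [|||||||s [Us' Hr' Hg' Es]] := IHm (Z :\ z) (z :: sg).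
- by move: leZm; rewrite (cardsD1 z Z) zZ.
- by rewrite /= Zsg.
- by have [s ->] := Hr; exists (z :: s).
- split; [|by right|by rewrite EZ].
  move=> u; rewrite !inE => /orP[/andP[_ /zmax]|/degT]; last lia.
  exact: leq_trans (geq_minl _ _).
- by move=> u; rewrite !inE negb_or => /andP[-> /Zsg].
- move=> B B0 sB; have [x [y [xB exy yB yZ]]] :=
    Hesc B B0 (subset_trans sB (subsetDl _ _)).
  by exists x, y; split=> //; rewrite Emem.
- by move=> t y y' tT ey ey'; rewrite !Emem; apply: (Hone t).
exists s; split=> // x; rewrite Es -[RHS]/((x \in Z) || (x \in sg)) -Emem.
by rewrite !inE.
Qed.

(** Arcs leaving the bad set [B] end in [t] or in [sc]. Once [T :\: B] takes the colour of [g],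
    vertices of [B] see only [t] in that colour, and [col_gate] at [t] prevents subsets of [B] from
    being cut off from [sc]. *)
Lemma color_unsafe i j c g sc sg T t (B := maxbad sc T t) :
    coloring i j c g sc sg T -> t \in T -> B != set0 ->
  exists sg', coloring i j c g sc sg' B /\ bounded 1 sg' B.
Proof.
case=> H1 H2 H3 H4 H5 H6 H7 H8 H9 H10 tT B0.
have /andP[sB0 /stuckP HB] : bad sc T t B := maxbad_bad sc T t.
have sB : B \subset T := subset_trans sB0 (subsetDl _ _).
have tB : t \notin B by apply/negP => /(subsetP sB0); rewrite !inE eqxx.
have [Uc Hcg Ug] : [/\ uniq sc, ~~ has (mem sc) sg & uniq sg].
  by apply/and3P; rewrite -cat_uniq.
have outc x : x \in T -> x \notin sc.
  by move=> /H2; rewrite mem_cat negb_or => /andP[].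
have outg x : x \in T -> x \notin sg.
  by move=> /H2; rewrite mem_cat negb_or => /andP[].
have cg x : x \in sg -> x \notin sc by move=> /(hasPn Hcg).
have Bone x y : x \in B -> e x y -> (y \in T :\: B) || (y \in sg) -> y = t.
  move=> xB exy; have := HB x y xB exy; rewrite !inE.
  case: (boolP (y \in B)) => [yB _|_ /predU1P[//|ysc]].
    by move=> /= ysg; have := outg y (subsetP sB y yB); rewrite ysg.
  by case/orP => [/outc|/cg]; rewrite ysc.
have [||||||s [Us Hr Hgs Es]] := @color_all j B (T :\: B) sg g => //.
- rewrite (_ : _ :|: _ = T) //; apply/setP => x; rewrite !inE.
  by case: (boolP (x \in B)) => [/(subsetP sB)->|]; rewrite ?orbT ?orbF.
- by move=> z; rewrite !inE => /andP[_ /outg].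
(* If [Z] had no such arc, [Z :|: B] would be stuck at [sc] when [t \in Z], against [col_escg], and
   bad otherwise, against the maximality of [B]. *)
- move=> Z Z0 sZ; have sZT : Z \subset T := subset_trans sZ (subsetDl _ _).
  case: (boolP [exists x in Z, exists y,
      [&& e x y, y \notin Z & (y \in T :\: B) || (y \in sg)]]).
    case/exists_inP=> x xZ /existsP[y /and3P[exy yZ yT]].
    by exists x, y.
  rewrite negb_exists_in => /forall_inP Hno.
  have HZ x y : x \in Z -> e x y -> [|| y \in Z :|: B | y \in sc].
    move=> xZ exy; have := Hno x xZ.
    rewrite negb_exists => /forallP/(_ y); rewrite exy !inE /=.
    have /stuckP/(_ x y (subsetP sZT x xZ) exy) := H3; rewrite mem_cat.
    by case: (y \in Z) (y \in B) (y \in T) (y \in sc) (y \in sg)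
      => [] [] [] [] [].
  have UZ0 : Z :|: B != set0 by rewrite setU_eq0 negb_and Z0.
  have sU : Z :|: B \subset T by rewrite subUset sZT.
  have [tZ | tZ] := boolP (t \in Z).
    have /negP[] := H9 _ UZ0 sU; apply/stuckP => x y.
    rewrite in_setU => /orP[xZ /(HZ x y xZ)|xB /(HB x y xB)] //.
    rewrite in_setU inE => /or3P[->|/eqP->|->]; rewrite ?tZ ?orbT //.
  have : bad sc T t (Z :|: B).
    rewrite /bad subsetD1 sU in_setU (negPf tZ) (negPf tB) /=.
    apply/stuckP => x y.
    rewrite in_setU => /orP[xZ /(HZ x y xZ)|xB /(HB x y xB)].
      by case/orP=> [->//|ysc]; rewrite in_cons ysc !orbT.
    by case/orP=> [yB|->]; rewrite ?orbT // in_setU yB orbT.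
  move/maxbad_sup; rewrite subUset => /andP[sZB _].
  have [z zZ] := set0Pn _ Z0.
  by have := subsetP sZ z zZ; rewrite inE (subsetP sZB).
- move=> x y y' xB exy exy' yi yi'.
  by rewrite (Bone x y) // (Bone x y').
have Emem y : (y \in s) = (y \in T :\: B) || (y \in sg) by rewrite Es.
exists s; split; last first.
  move=> x xB; rewrite /deg -size_filter.
  have : uniq (filter (e x) s) by apply: filter_uniq.
  have : all (fun y => e x y && (y \in s)) (filter (e x) s).
    by apply/allP => y; rewrite mem_filter.
  case: (filter _ _) => [|y [|y' s']] //= /and3P[/andP[uy yi] /andP[uy' yi'] _].
  by rewrite (Bone x y) -?Emem // (Bone x y') -?Emem // inE eqxx.
split=> //.
- rewrite cat_uniq Us andbT Uc; apply/hasPn => x; rewrite Emem !inE.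
  by case/orP=> [/andP[_ /outc]|/cg].
- move=> x xB; rewrite mem_cat Emem !inE xB /=.
  by rewrite -mem_cat; apply: H2; apply: (subsetP sB).
- apply/stuckP => x y xB exy; rewrite mem_cat Emem !inE.
  have /orP[->//|] := HB x y xB exy.
  by rewrite inE => /predU1P[->|->]; rewrite ?tT ?tB ?orbT.
- exact: greedy_sub H6.
- move=> B' B'0 sB'; have sB'T := subset_trans sB' sB.
  apply: contra (H10 B' t B'0 sB'T) => /stuckP HB'; apply/stuckP => x y xB' exy.
  have := HB' x y xB' exy; rewrite Emem => /orP[->//|yi].
  have -> : y = t by apply: (Bone x y) => //; apply: (subsetP sB').
  by rewrite mem_head orbT.
- by move=> B' B'0 sB'; apply: H9 B'0 (subset_trans sB' sB).
by move=> B' x B'0 sB'; apply: H10 B'0 (subset_trans sB' sB).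
Qed.

(** * The search for an apex *)

Definition has_apex i j c g := exists sc sg T t,
  [/\ coloring i j c g sc sg T, t \in T, i <= deg sc t & j <= deg sg t].

Lemma has_apex_swap i j c g : has_apex i j c g -> has_apex j i g c.
Proof.
by move=> [sc [sg [T [t [/coloring_swap H tT ? ?]]]]]; exists sg, sc, T, t.
Qed.

(** This is the induction hypothesis of [coloring_has_apex], named for its auxiliary lemmas. *)
Definition small_apex m i j c g := forall sc sg T,
  coloring i j c g sc sg T -> T != set0 -> #|T| < m ->
  bounded i sc T -> bounded j sg T -> has_apex i j c g.

Lemma small_apex_swap m i j c g : small_apex m i j c g -> small_apex m j i g c.
Proof.
move=> H sc sg T /coloring_swap Hcol T0 ltT bc bg.
by apply: has_apex_swap; apply: H Hcol _ _ _ _.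
Qed.

Lemma boundedW m n s T : m <= n -> bounded m s T -> bounded n s T.
Proof. by move=> le H t /H; move/leq_trans; apply. Qed.

Lemma bounded_sub n s T T' : T' \subset T -> bounded n s T -> bounded n s T'.
Proof. by move=> /subsetP sT H t /sT; apply: H. Qed.

Lemma maxbad_subT sc T t : maxbad sc T t \subset T :\ t.
Proof. by case/andP: (maxbad_bad sc T t). Qed.

Lemma card_maxbad sc T t : t \in T -> #|maxbad sc T t| < #|T|.
Proof.
move=> tT; rewrite (cardsD1 t T) tT ltnS.
exact: subset_leq_card (maxbad_subT _ _ _).
Qed.

(** As [r'] lies in [B], arcs leaving [B :|: B'] end in [r] or [sc]. By [col_escg], [r] is not in
    [B']; so the union is bad for [r], and [B'] is contained in [B] but misses [r']. *)
Lemma maxbad_nested i j c g sc sg T r r' :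
    coloring i j c g sc sg T -> r \in T -> r' \in maxbad sc T r ->
  #|maxbad sc T r'| < #|maxbad sc T r|.
Proof.
move=> Hcol rT r'B; set B := maxbad sc T r; set B' := maxbad sc T r'.
have /andP[sB /stuckP HB] : bad sc T r B := maxbad_bad sc T r.
have /andP[sB' /stuckP HB'] : bad sc T r' B' := maxbad_bad sc T r'.
have sBB' : B :|: B' \subset T.
  rewrite subUset (subset_trans sB (subsetDl _ _)).
  exact: subset_trans sB' (subsetDl _ _).
have HBB' x y : x \in B :|: B' -> e x y ->
    [|| y \in B :|: B', y == r | y \in sc].
  rewrite !inE => /orP[xB|xB'] exy.
    by have := HB x y xB exy; rewrite inE => /or3P[->|->|->]; rewrite ?orbT.
  have := HB' x y xB' exy; rewrite inE => /or3P[->|/eqP->|->]; rewrite ?orbT //.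
  by rewrite r'B.
have rB' : r \notin B'.
  apply/negP => rB'; have BB0 : B :|: B' != set0.
    by apply/set0Pn; exists r'; rewrite inE r'B.
  have /negP[] := col_escg Hcol BB0 sBB'; apply/stuckP => x y xB exy.
  by have /or3P[->|/eqP->|->] := HBB' x y xB exy; rewrite ?inE ?rB' ?orbT.
have rB : r \notin B by apply/negP => /(subsetP sB); rewrite !inE eqxx.
have : bad sc T r (B :|: B').
  rewrite /bad subsetD1 sBB' in_setU (negPf rB) (negPf rB') /=.
  by apply/stuckP => x y xB exy; rewrite in_cons; apply: HBB' exy.
move/maxbad_sup; rewrite subUset => /andP[_ sB'B].
apply: proper_card; apply/properP; split=> //; exists r' => //.
by apply/negP => /(subsetP sB'); rewrite !inE eqxx.
Qed.

(* [x] saturates colour [g]. Vertices of degree more than [i] to colour [c] are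
   coloured one by one; as [x] is never coloured, this stops at a bounded
   colouring unless [x] becomes an apex. *)
Lemma close_coloring m i j c g sc sg T x :
    small_apex m i j c g -> coloring i j c g sc sg T -> 0 < j -> #|T| < m ->
    bounded j sg T -> x \in T -> j <= deg sg x -> has_apex i j c g.
Proof.
move=> Hm Hcol j_gt0; have [n leTn] := ubnP #|T|.
elim: n sc T leTn Hcol => // n IHn sc T leTn Hcol ltTm bg xT jx.
have [ix | xi] := leqP i (deg sc x); first by exists sc, sg, T, x.
have [/exists_inP[r0 r0T ir0] | ] := boolP [exists r in T, i < deg sc r]; last first.
  rewrite negb_exists_in => /forall_inP bc; apply: Hm Hcol _ ltTm _ bg.
    by apply/set0Pn; exists x.
  by move=> t /bc; rewrite -leqNgt.
pose P := [pred r | (r \in T) && (i < deg sc r)].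
have Pr0 : P r0 by rewrite /= r0T.
(* Take [r] of degree above [i] with the smallest [maxbad]. If this set is empty, [r] can be
   coloured; otherwise [maxbad_nested] shows that no vertex inside it has degree above [i], and
   [color_unsafe] applies. *)
case: (@arg_minnP _ r0 P (fun r => #|maxbad sc T r|) Pr0) => r /andP[rT ir] minr.
have [mb0 | mbn0] := eqVneq (maxbad sc T r) set0.
  have xr : x != r by apply: contraTneq ir => <-; rewrite -leqNgt ltnW.
  apply: (IHn (r :: sc) (T :\ r)) => //.
  - by move: leTn; rewrite (cardsD1 r T) rT.
  - apply: color_safe => //; last exact: leq_trans ir.
    by move=> u _; apply: leq_trans (geq_minr _ _) (ltnW ir).
  - by apply: leq_trans ltTm; rewrite ltnS subset_leq_card ?subsetDl.
  - by apply: bounded_sub bg; apply: subsetDl.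
  - by rewrite !inE xr.
have [sg' [Hcol' bg']] := color_unsafe Hcol rT mbn0.
apply: Hm Hcol' mbn0 _ _ (boundedW j_gt0 bg').
  exact: ltn_trans (card_maxbad _ rT) ltTm.
move=> t tB; rewrite leqNgt; apply/negP => it.
have := maxbad_nested Hcol rT tB; rewrite ltnNge minr //= it andbT.
exact: subsetP (subset_trans (maxbad_subT _ _ _) (subsetDl _ _)) t tB.
Qed.

(** As long as all degrees to [sc] are below [i], colouring a vertex of largest degree raises them
    by at most 1 and keeps the bound [i]; if this is unsafe, [color_unsafe] passes to a smaller
    set. *)
Lemma saturated_vertex m i j c g sc sg T :
    irreflexive e -> (forall x, i + j <= #|[set y | e x y]|) -> 0 < j ->
    small_apex m i j c g -> coloring i j c g sc sg T -> T != set0 -> #|T| <= m ->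
    bounded i sc T -> bounded j sg T ->
  has_apex i j c g \/ exists2 t, t \in T & i <= deg sc t.
Proof.
move=> irr hdeg j_gt0 Hm Hcol T0 leTm bc bg; have [t0 t0T] := set0Pn _ T0.
case: (@arg_maxnP _ t0 [in T] (deg sc) t0T) => t tT tmax.
have [it | ti] := leqP i (deg sc t); [by right; exists t | left].
have degt : 0 < deg sc t.
  have := col_escc Hcol T0 (subxx T).
  rewrite negb_forall_in => /exists_inP[x xT].
  rewrite negb_forall => /existsP[y]; rewrite negb_imply negb_or.
  case/and3P=> exy yT yg; apply: leq_trans (tmax x xT).
  rewrite -has_count; apply/hasP; exists y => //.
  have /stuckP/(_ x y xT exy) := col_all Hcol.
  by rewrite (negPf yT) mem_cat (negPf yg) orbF.
have [mb0 | mbn0] := eqVneq (maxbad sc T t) set0; last first.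
  have [sg' [Hcol' bg']] := color_unsafe Hcol tT mbn0.
  apply: Hm Hcol' mbn0 _ _ (boundedW j_gt0 bg').
    exact: leq_trans (card_maxbad _ tT) leTm.
  exact: bounded_sub (subset_trans (maxbad_subT _ _ _) (subsetDl _ _)) bc.
apply: (Hm (t :: sc) sg (T :\ t)).
- apply: color_safe => // u uT; exact: leq_trans (geq_minl _ _) (tmax u uT).
(* If [t] were the last uncoloured vertex, it would have fewer than [i] out-neighbours in [sc], at
   most [j] in [sg], and no others. *)
- apply/negP => /eqP T1.
  have : #|[set y | e t y]| <= deg (sc ++ sg) t.
    rewrite /deg -size_filter cardE; apply: uniq_leq_size (enum_uniq _) _ => y.
    rewrite mem_enum inE mem_filter => ety; rewrite ety /=.
    have /stuckP/(_ t y tT ety)/orP[yT|//] := col_all Hcol.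
    have : y \in T :\ t by rewrite !inE yT andbT; apply: contraTneq ety => ->; rewrite irr.
    by rewrite T1 inE.
  rewrite /deg count_cat; move: (hdeg t) (bg t tT) ti; rewrite /deg; clear; lia.
- by move: leTm; rewrite (cardsD1 t T) tT.
- move=> u; rewrite inE => /andP[_ uT]; rewrite /deg /= -/(deg sc u).
  have := tmax u uT; move: ti; clear; rewrite /=; case: (e u t); lia.
exact: bounded_sub (subsetDl _ _) bg.
Qed.

Lemma coloring_has_apex i j c g sc sg T :
    irreflexive e -> (forall x, i + j <= #|[set y | e x y]|) -> 0 < i -> 0 < j ->
    coloring i j c g sc sg T -> T != set0 -> bounded i sc T -> bounded j sg T ->
  has_apex i j c g.
Proof.
move=> irr hdeg i_gt0 j_gt0; have [m leTm] := ubnP #|T|.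
elim: m sc sg T leTm => // m IHm sc sg T leTm Hcol T0 bc bg.
have Hm : small_apex m i j c g by move=> sc' sg' T' H1 H2 H3; apply: IHm H3 H1 H2.
have hdeg' x : j + i <= #|[set y | e x y]| by rewrite addnC.
have [//|[t tT it]] := saturated_vertex irr hdeg j_gt0 Hm Hcol T0 leTm bc bg.
have [/has_apex_swap //|[x xT jx]] := saturated_vertex irr hdeg' i_gt0
  (small_apex_swap Hm) (coloring_swap Hcol) T0 leTm bg bc.
have [ix | xi] := leqP i (deg sc x); first by exists sc, sg, T, x.
have [mb0 | mbn0] := eqVneq (maxbad sc T t) set0; last first.
  have [sg' [Hcol' bg']] := color_unsafe Hcol tT mbn0.
  apply: Hm Hcol' mbn0 _ _ (boundedW j_gt0 bg').
    exact: leq_trans (card_maxbad _ tT) leTm.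
  exact: bounded_sub (subset_trans (maxbad_subT _ _ _) (subsetDl _ _)) bc.
(* Colouring [t] may push degrees to colour [c] up to [i + 1]; [close_coloring] repairs this, with
   [x] as the vertex saturated in colour [g]. *)
apply: (@close_coloring m i j c g (t :: sc) sg (T :\ t) x) => //.
- apply: color_safe => //; last exact: leq_trans it.
  by move=> u _; apply: leq_trans (geq_minr _ _) it.
- by move: leTm; rewrite (cardsD1 t T) tT.
- exact: bounded_sub (subsetDl _ _) bg.
by rewrite !inE xT andbT; apply: contraTneq it => <-; rewrite -ltnNge.
Qed.

(** Subsets of [A :\ c :\ g] miss [c], so the minimality of [A] gives [col_gate]; with one-vertex
    colours, both escape conditions are instances of it. *)
Lemma initial_coloring i j :
    irreflexive e -> 1 < i + j -> 0 < #|V| ->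
    (forall x, i + j <= #|[set y | e x y]|) ->
  exists c g T, [/\ e c g, coloring i j c g [:: c] [:: g] T & T != set0].
Proof.
move=> irr ij V_gt0 hdeg.
pose P := [pred A : {set V} | (A != set0) && [exists x, stuck A [:: x]]].
have [v _] : exists v : V, v \in V by apply/card_gt0P.
have PT : P setT.
  apply/andP; split; first by apply/set0Pn; exists v; rewrite inE.
  by apply/existsP; exists v; apply/stuckP => x y _ _; rewrite inE.
case: (@arg_minnP _ setT P (fun A => #|A|) PT) => A /andP[A0 /existsP[x0 HA]] minA.
(* An arc leaving [A] ends in [x0], which then serves as [g]. If no arc leaves [A], any arc inside
   [A] will do. *)
have [c [g [cA ecg sA]]] : exists c g, [/\ c \in A, e c g & stuck A [:: g]].
  have [/exists_inP[c cA /andP[ecx _]] | ] :=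
      boolP [exists c in A, e c x0 && (x0 \notin A)].
    by exists c, x0.
  rewrite negb_exists_in => /forall_inP Hx0; have [c cA] := set0Pn _ A0.
  have /card_gt0P[g] : 0 < #|[set y | e c y]| by apply: leq_trans (hdeg c); lia.
  rewrite inE => ecg; exists c, g; split=> //; apply/stuckP => x y xA exy.
  have /stuckP/(_ x y xA exy) := HA; rewrite !inE => /orP[->//|/eqP Ey].
  by have := Hx0 x xA; rewrite -Ey exy /= negbK => ->.
have cg : c != g by apply: contraTneq ecg => ->; rewrite irr.
exists c, g, (A :\ c :\ g).
have sT : A :\ c :\ g \subset A by rewrite !subDset !setUA subsetUr.
have gate B x : B != set0 -> B \subset A :\ c :\ g -> ~~ stuck B [:: x].
  move=> B0 sB; apply/negP => HB; have /minA : P B.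
    by rewrite /= B0; apply/existsP; exists x.
  rewrite leqNgt => /negP[]; apply: proper_card; apply/properP; split.
    exact: subset_trans sB sT.
  by exists c => //; apply/negP => /(subsetP sB); rewrite !inE eqxx andbF.
split=> //.
- split=> //=; rewrite ?inE ?cg //; try by exists [::].
  + by move=> t; rewrite !inE negb_or => /and3P[-> ->].
  + apply/stuckP => x y xT exy.
    have /stuckP/(_ x y (subsetP sT x xT) exy) := sA; rewrite !inE.
    by case: (y == c) (y == g) => [] [].
  + by split=> //; [move=> u _; rewrite min0n | left].
  + by split=> //; [move=> u _; rewrite min0n | left].
  + by move=> B; apply: gate.
  + by move=> B; apply: gate.
have : 0 < #|[set y | e c y] :\ g|.
  have := hdeg c; rewrite (cardsD1 g) inE ecg; lia.
case/card_gt0P => y; rewrite !inE => /andP[yg ecy].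
apply/set0Pn; exists y; rewrite !inE yg /=.
have /stuckP/(_ c y cA ecy) := sA; rewrite inE (negPf yg) orbF => ->.
by rewrite andbT; apply: contraTneq ecy => ->; rewrite irr.
Qed.

Lemma exists_apex i j :
    irreflexive e -> 0 < i -> 0 < j -> 0 < #|V| ->
    (forall x, i + j <= #|[set y | e x y]|) ->
  exists c g, e c g /\ has_apex i j c g.
Proof.
move=> irr i_gt0 j_gt0 V_gt0 hdeg; have ij : 1 < i + j by lia.
have [c [g [T [ecg Hcol T0]]]] := initial_coloring irr ij V_gt0 hdeg.
exists c, g; split=> //; apply: coloring_has_apex Hcol T0 _ _ => // t _.
  by rewrite /deg /= addn0; apply: leq_trans i_gt0; apply: leq_b1.
by rewrite /deg /= addn0; apply: leq_trans j_gt0; apply: leq_b1.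
Qed.

End Coloring.

(** * Subdivisions *)

(* [path] also defines an [arc] *)
Local Notation arc := (@Defs.arc _).

Lemma path_arcP (T : eqType) (p : seq T) x y :
  reflect (exists p1 p2, p = p1 ++ x :: y :: p2) (path_arc p x y).
Proof.
by rewrite /path_arc; apply: (iffP (@infixP T [:: x; y] p)) => -[p1 [p2 ->]]; exists p1, p2.
Qed.

Lemma path_arc_sorted (T : eqType) (e : rel T) p x y :
  sorted e p -> path_arc p x y -> e x y.
Proof.
by move=> + /path_arcP[p1 [p2 Ep]]; rewrite Ep => /cat_sorted2[_ /= /andP[]].
Qed.

Lemma path_arc_map (T T' : eqType) (f : T -> T') p x y : injective f ->
  path_arc (map f p) (f x) (f y) = path_arc p x y.
Proof.
move=> fI; apply/path_arcP/path_arcP => -[p1 [p2 E]]; last first.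
  by exists (map f p1), (map f p2); rewrite E map_cat.
exists (take (size p1) p), (drop (size p1 + 2) p); apply: (inj_map fI).
rewrite map_cat /= map_take map_drop E take_size_cat // drop_cat.
by rewrite ltnNge leq_addr addKn /= drop0.
Qed.

Lemma path_arc_nth (T : eqType) (x0 : T) p x y : path_arc p x y ->
  exists n, [/\ n.+1 < size p, nth x0 p n = x & nth x0 p n.+1 = y].
Proof.
case/path_arcP=> p1 [p2 ->]; exists (size p1); split.
- by rewrite size_cat /=; lia.
- by rewrite nth_cat ltnn subnn.
by rewrite nth_cat ltnNge leqnSn /= subSnn.
Qed.

Section Embedding.

Variables (D F : digraph) (b : F -> D) (P : F -> F -> seq D).
Hypotheses (b_inj : injective b)
  (P_inner : forall u v, arc u v ->
     uniq (P u v) /\ forall w, b w \notin P u v)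
  (P_disj : forall u v u' v', arc u v -> arc u' v' -> (u, v) <> (u', v') ->
     forall x, ~ (x \in P u v /\ x \in P u' v'))
  (P_path : forall u v, arc u v -> path arc (b u) (rcons (P u v) (b v))).

Let full u v := b u :: rcons (P u v) (b v).

Let used x := [exists w, b w == x] ||
  [exists u, exists v, arc u v && (x \in P u v)].

(** A subdivision consists of exactly the vertices and arcs of its paths, so the witness is a
    subtype with only the path arcs rather than an induced subdigraph. *)
Let S := {x : D | used x}.

Let S_arc : rel S := fun x y =>
  [exists u, exists v, arc u v && path_arc (full u v) (val x) (val y)].

Let S_irr : irreflexive S_arc.
Proof.
move=> x; apply/negbTE/negP => /existsP[u /existsP[v /andP[uv]]].
rewrite path_arc_irr //= rcons_uniq mem_rcons inE.
have [-> Hb] := P_inner uv; rewrite !(negPf (Hb _)) orbF !andbT.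
by apply: contraTneq uv => /b_inj ->; rewrite arc_irr.
Qed.

Let b_used w : used (b w).
Proof. by apply/orP; left; apply/existsP; exists w. Qed.

Let S_gt0 : 0 < #|{: S}|.
Proof.
have /card_gt0P[w _] := vertex_gt0 F.
by apply/card_gt0P; exists (Sub (b w) (b_used w)).
Qed.

Let SD := Digraph S_irr S_gt0.

Let bS w : SD := Sub (b w) (b_used w).
Let PS u v : seq SD := pmap insub (P u v).

Let val_PS u v : arc u v -> map val (PS u v) = P u v.
Proof.
move=> uv; rewrite /PS (pmap_filter (insubK _)); apply/all_filterP/allP => x xP /=.
rewrite isSome_insub; apply/orP; right.
by apply/existsP; exists u; apply/existsP; exists v; rewrite uv.
Qed.

Lemma contains_subdivision_of_paths : contains_subdivision D F.
Proof.
have mem_PS u v (x : SD) : (x \in PS u v) = (val x \in P u v).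
  by rewrite mem_pmap_sub.
exists SD; split; last first.
  exists val; split; first exact: val_inj.
  move=> x y /existsP[u] /existsP[v] /andP[uv]; apply: path_arc_sorted.
  exact: P_path.
exists bS, PS; split.
- by move=> u v /(congr1 val) /b_inj.
- move=> u v uv; have [UP bP] := P_inner uv.
  split; first by rewrite -(map_inj_uniq val_inj) val_PS.
  by move=> w; rewrite mem_PS; apply: bP.
- move=> u v u' v' uv uv' ne x [xP xP']; apply: (P_disj uv uv' ne (x := val x)).
  by rewrite -!mem_PS.
- move=> x; case/orP: (valP x) => [/existsP[w /eqP Ew]|].
    by left; exists w; apply: val_inj.
  case/existsP=> u /existsP[v /andP[uv xP]]; right; exists u, v.
  by split=> //; rewrite mem_PS.
have Efull u v : arc u v -> map val (full_path bS PS u v) = full u v.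
  by move=> uv; rewrite /full_path /= map_rcons val_PS.
move=> x y; split.
  case/existsP=> u /existsP[v /andP[uv]].
  by rewrite -Efull // path_arc_map; [exists u, v | apply: val_inj].
case=> u [v [uv xy]]; apply/existsP; exists u; apply/existsP; exists v.
by rewrite uv -Efull // path_arc_map //; apply: val_inj.
Qed.

End Embedding.

(** * Assembling [Hstar] from two legs *)

Lemma uniq_flatten_nth (T : eqType) (ss : seq (seq T)) m n x :
  uniq (flatten ss) -> x \in nth [::] ss m -> x \in nth [::] ss n -> m = n.
Proof.
elim: ss m n => [|s ss IHss] [|m] [|n] //=; rewrite cat_uniq => /and3P[_ Hs Us].
- move=> xs xn; case/hasP: Hs; exists x => //; apply/flattenP.
  exists (nth [::] ss n) => //; apply: mem_nth.
  by case: leqP xn => // le; rewrite nth_default.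
- move=> xn xs; case/hasP: Hs; exists x => //; apply/flattenP.
  exists (nth [::] ss m) => //; apply: mem_nth.
  by case: leqP xn => // le; rewrite nth_default.
by move=> xm xn; rewrite (IHss m n).
Qed.

Lemma uniq_flatten_mem (T : eqType) (ss : seq (seq T)) s :
  uniq (flatten ss) -> s \in ss -> uniq s.
Proof.
elim: ss => //= s' ss IHss; rewrite cat_uniq => /and3P[Us' _ Uss].
by rewrite inE => /predU1P[->|/IHss]; [|apply].
Qed.

Lemma leg_spine_step (V : finType) (e : rel V) h0 (L : leg V) n :
    sorted e (leg_spine L) -> n.+1 < size L ->
  path e (nth h0 L n).1.2 (rcons (nth h0 L n).2 (nth h0 L n.+1).1.2).
Proof.
elim: L n => // h L IHL [|n]; rewrite /leg_spine /= -/(leg_spine L).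
  case: L {IHL} => // h' L; rewrite /leg_spine /= cat_path rcons_path.
  by case/andP=> -> /= /andP[].
by rewrite cat_path => /andP[_ /path_sorted]; apply: IHL.
Qed.

(** Its use is to index arcs by single vertices: an arc out of 0 is determined by [v], any other arc
    by [u]. *)
Lemma Hstar_arcP k1 k2 (hk1 : 0 < k1) (u v : Hstar k1 k2 hk1) : 0 < k2 ->
    arc u v ->
  val v != 0 /\
  if val u == 0 then (val v == k1) ==> ((k1 == 1) || (k2 == 1))
  else if val u < k1 then val v == (val u).+1
  else (k1 < val u) && (val v == if (val u).+1 < k1 + k2 then (val u).+1 else k1).
Proof.
move=> hk2; have ltv := ltn_ord v; have ltu := ltn_ord u; case/orP; last first.
  by case/and3P=> -> -> /negPf->.
case/orP=> /(path_arc_nth 0)[n []].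
  rewrite size_iota => ltn; rewrite !nth_iota //; last lia.
  move=> <- <-; rewrite !add0n; split=> //.
  case: n ltn => [|n] ltn //=; last by rewrite ltnS in ltn; rewrite ltn.
  by apply/implyP => /eqP <-.
rewrite /path2 /= size_rcons size_iota => ltn.
case: n ltn => [|n] ltn /=.
  move=> <-; rewrite nth_rcons size_iota; case: ltnP => [lt0|ge0].
    rewrite nth_iota // => <-; rewrite addn0; split=> //=.
    by rewrite (gtn_eqF (ltnSn k1)).
  have E : k2.-1 = 0 by lia.
  rewrite E eqxx => <-; split; first by rewrite -lt0n.
  by rewrite /= eqxx /=; apply/orP; right; apply/eqP; lia.
rewrite !nth_rcons size_iota.
have -> : n < k2.-1 by lia.
have E1 : (k1.+1 + n == 0) = false by lia.
have E2 : (k1.+1 + n < k1) = false by lia.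
have E3 : k1 < k1.+1 + n by lia.
rewrite nth_iota; last lia.
case: (ltnP n.+1 k2.-1) => [lt1|le1].
  rewrite nth_iota // => <- <-; rewrite E1 E2 E3; split; first lia.
  by case: ifP => H; apply/eqP; lia.
case: eqP => [E|]; last lia.
move=> <- <-; rewrite E1 E2 E3; split; first lia.
by case: ifP => H; apply/eqP; lia.
Qed.

Definition legs_to (V : finType) (e : rel V) a b (L : leg V) :=
  [&& sorted e (rcons (leg_spine L) b), leg_fans e L & all (e a) (leg_starts L)].

(** The branch vertices are [a], [b] and the hits. Inner paths of hits replace the arcs out of [a],
    including the first arcs of both paths of [C]; spine segments replace the remaining arcs. *)
Lemma Hstar_of_legs k1 k2 (hk1 : 0 < k1) (D : digraph) (a b : D) (L1 L2 : leg D) :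
    0 < k2 -> size L1 = k1.-1 -> size L2 = k2.-1 ->
    legs_to arc a b L1 -> legs_to arc a b L2 ->
    uniq (a :: b :: leg_vertices L1 ++ leg_vertices L2) ->
    (k1 = 1 \/ k2 = 1 -> arc a b) ->
  contains_subdivision D (Hstar k1 k2 hk1).
Proof.
move=> hk2 sz1 sz2 /and3P[sp1 fan1 st1] /and3P[sp2 fan2 st2] U ab.
(* Dummy hits stand for [a] and [b], so that entry [v] of [E] describes vertex [v] of [Hstar]: [a]
   at 0 and [b] at [k1]. *)
pose h0 : seq D * D * seq D := ([::], a, [::]).
pose hb : seq D * D * seq D := ([::], b, [::]).
pose E := h0 :: L1 ++ hb :: L2.
have szE : size E = k1 + k2 by rewrite /= size_cat /= sz1 sz2; lia.
pose q v := (nth h0 E v).1.1; pose y v := (nth h0 E v).1.2.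
pose r v := (nth h0 E v).2.
have UE : uniq (leg_vertices E).
  have -> : leg_vertices E = a :: leg_vertices L1 ++ b :: leg_vertices L2.
    by rewrite /leg_vertices /= map_cat flatten_cat.
  have pU : perm_eq (a :: b :: leg_vertices L1 ++ leg_vertices L2)
                    (a :: leg_vertices L1 ++ b :: leg_vertices L2).
    by apply/permP => p; rewrite /= !count_cat /=; clear; lia.
  by rewrite -(perm_uniq pU).
pose blk := [seq h.1.1 ++ h.1.2 :: h.2 | h <- E].
have blkE v : v < k1 + k2 -> nth [::] blk v = q v ++ y v :: r v.
  by move=> ltv; rewrite (nth_map h0) ?szE.
have sepE u v x : u < k1 + k2 -> v < k1 + k2 -> x \in q u ++ y u :: r u ->
    x \in q v ++ y v :: r v -> u = v.
  by move=> ltu ltv; rewrite -!blkE //; apply: uniq_flatten_nth.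
have Ublk v : v < k1 + k2 -> uniq (q v ++ y v :: r v).
  by move=> ltv; apply: uniq_flatten_mem UE _; rewrite -blkE // mem_nth // size_map szE.
have E1 v : 0 < v < k1 -> nth h0 E v = nth h0 L1 v.-1.
  by case: v => // v; rewrite /= nth_cat sz1 => lt; rewrite ifT //; lia.
have Eb : nth h0 E k1 = hb.
  by rewrite -(prednK hk1) /= nth_cat sz1 ltnn subnn.
have E2 v : k1 < v -> nth h0 E v = nth h0 L2 (v - k1.+1).
  case: v => // v lt; rewrite /= nth_cat sz1 ifF; last lia.
  by rewrite (_ : v - k1.-1 = (v - k1).+1) ?subSS //; lia.
have fan L n : leg_fans arc L -> all (arc a) (leg_starts L) -> n < size L ->
    path arc a (rcons (nth h0 L n).1.1 (nth h0 L n).1.2).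
  move=> /(all_nthP h0)/(_ n) + /(all_nthP a)/(_ n) + ltn.
  rewrite size_map (nth_map h0) // => /(_ ltn) + /(_ ltn).
  by case: (nth h0 L n) => [[[|x Q] z] R] /= => [_ ->|-> ->].
have step L n : sorted arc (rcons (leg_spine L) b) -> n < size L ->
    path arc (nth h0 L n).1.2 (rcons (nth h0 L n).2
      (if n.+1 < size L then (nth h0 L n.+1).1.2 else b)).
  have -> : rcons (leg_spine L) b = leg_spine (rcons L hb).
    by rewrite /leg_spine map_rcons flatten_rcons cats1.
  move=> sp ltn; have := leg_spine_step (n := n) h0 sp.
  rewrite size_rcons ltnS !nth_rcons ltn => /(_ isT).
  by case: (ltngtP n.+1 (size L)) => // ltL; rewrite ltnNge ltn in ltL.
have fanE v : v != 0 -> v < k1 + k2 ->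
    (v == k1) ==> ((k1 == 1) || (k2 == 1)) -> path arc a (rcons (q v) (y v)).
  rewrite -lt0n /q /y => v_gt0 ltv; case: (ltngtP v k1) => [lt1 _|lt1 _|->] /=.
  - rewrite E1 ?v_gt0 //; apply: fan => //; rewrite sz1; lia.
  - rewrite E2 //; apply: fan => //; rewrite sz2; lia.
  rewrite Eb /= andbT => /orP H; apply: ab.
  by case: H => /eqP; [left | right].
have step1 v : v != 0 -> v < k1 -> path arc (y v) (rcons (r v) (y v.+1)).
  rewrite -lt0n => v_gt0 lt1; have ltn : v.-1 < size L1 by rewrite sz1; lia.
  have := step L1 v.-1 sp1 ltn; rewrite prednK // sz1 /y /r E1 ?v_gt0 //.
  case: ifP => [lt2|le2]; first by rewrite E1 ?andTb //; lia.
  by rewrite (_ : v.+1 = k1) ?Eb //; lia.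
have step2 v : k1 < v -> v < k1 + k2 -> path arc (y v)
    (rcons (r v) (y (if v.+1 < k1 + k2 then v.+1 else k1))).
  move=> gt1 ltv; have ltn : v - k1.+1 < size L2 by rewrite sz2; lia.
  have := step L2 (v - k1.+1) sp2 ltn; rewrite sz2 /y /r E2 //.
  have -> : ((v - k1.+1).+1 < k2.-1) = (v.+1 < k1 + k2) by lia.
  case: ifP => _; last by rewrite Eb.
  by rewrite (E2 v.+1) ?(ltn_trans gt1) // subSn.
pose br (v : Hstar k1 k2 hk1) := y (val v).
pose P (u v : Hstar k1 k2 hk1) := if val u == 0 then q (val v) else r (val u).
have yblk v : y v \in q v ++ y v :: r v by rewrite mem_cat mem_head orbT.
have Pblk u v x : x \in P u v ->
    x \in q (if val u == 0 then val v else val u) ++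
      y (if val u == 0 then val v else val u)
      :: r (if val u == 0 then val v else val u).
  by rewrite /P mem_cat inE; case: ifP => _ ->; rewrite ?orbT.
have ltb (u v : Hstar k1 k2 hk1) :
    (if val u == 0 then val v else val u) < k1 + k2.
  by case: ifP => _; apply: ltn_ord.
have Uy v : v < k1 + k2 ->
    [/\ y v \notin q v, y v \notin r v & forall x, x \in q v -> x \notin r v].
  move=> /Ublk; rewrite cat_uniq /= negb_or.
  case/and3P=> _ /andP[yq /hasPn qr] /andP[yr _]; split=> // x xq.
  by apply: contraL xq => /qr.
have yP (w u v : Hstar k1 k2 hk1) : br w \notin P u v.
  apply/negP => wP.
  have : val w = if val u == 0 then val v else val u.
    exact: sepE (ltn_ord w) (ltb u v) (yblk _) (Pblk _ _ _ wP).
  move: wP; rewrite /P /br; case: ifP => _ + Ew; rewrite Ew.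
    by apply/negP; have [] := Uy _ (ltn_ord v).
  by apply/negP; have [] := Uy _ (ltn_ord u).
apply: (@contains_subdivision_of_paths D (Hstar k1 k2 hk1) br P).
- move=> u v Euv; apply: val_inj.
  by apply: (sepE _ _ (br u) (ltn_ord u) (ltn_ord v) (yblk _)); rewrite Euv yblk.
- move=> u v _; split=> // .
  have := Ublk _ (ltb u v); rewrite /P cat_uniq /= => /and3P[+ _ /andP[_ +]].
  by case: ifP.
(* Arcs whose paths share [x] use the same block of [E]. Inside a block [q] and [r] are disjoint, so
   both arcs leave 0 or neither does, and the block determines the arc. *)
- move=> u v u' v' uv uv' ne x [xP xP'].
  have : (if val u == 0 then val v else val u)
       = if val u' == 0 then val v' else val u'.
    exact: sepE (ltb u v) (ltb u' v') (Pblk _ _ _ xP) (Pblk _ _ _ xP').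
  have [v0 Hv] := Hstar_arcP hk2 uv; have [v0' Hv'] := Hstar_arcP hk2 uv'.
  have [_ _ qv] := Uy (val v) (ltn_ord v).
  have [_ _ qv'] := Uy (val v') (ltn_ord v').
  move: xP xP' Hv Hv'; rewrite /P.
  case: eqP => u0; case: eqP => u0' + + + + Ez; move: Ez.
  - by move=> Ez _ _ _ _; apply: ne; congr pair; apply: val_inj; rewrite ?u0.
  - by move=> Ez /qv; rewrite Ez => /negPf->.
  - by move=> Ez + /qv'; rewrite -Ez => ->.
  move=> Ez _ _; rewrite -Ez => Hv Hv'; apply: ne; congr pair; apply: val_inj => //.
  move: Hv Hv'; case: ifP => [_ /eqP-> /eqP->//|_ /andP[_ /eqP->] /andP[_ /eqP->]//].
move=> u v uv; have [v0] := Hstar_arcP hk2 uv; rewrite /br /P.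
case: ifP => [/eqP-> Hv|/negbT u0]; first exact: fanE (ltn_ord v) Hv.
case: ifP => [ltu /eqP->|_ /andP[gtu /eqP->]]; first exact: step1.
exact: step2 (ltn_ord u).
Qed.

(** * Legs along a longest path, and trimmed legs *)

(** Along [s], the first [n] out-neighbours of [a] become hits with empty inner path, the next one
    is [b], and [R] is what precedes the first of them. The clause over all [x] lets the induction
    prepend a vertex. *)
Lemma leg_along_path (V : finType) (e : rel V) a n (s : seq V) :
    sorted e s -> uniq s -> n < count (e a) s ->
  exists R (L : leg V) b,
    [/\ size L = n, sorted e (R ++ rcons (leg_spine L) b)
        /\ (forall x, path e x s -> path e x (R ++ rcons (leg_spine L) b)),
        leg_fans e L, all (e a) (b :: leg_starts L)
      & uniq (b :: R ++ leg_vertices L)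
        /\ {subset b :: R ++ leg_vertices L <= s}].
Proof.
elim: s n => // x s IHs n /= Hp /andP[xs Us]; have Hs := path_sorted Hp.
have [ax | ax] := boolP (e a x); last first.
  rewrite add0n => /(IHs _ Hs Us)[R [L [b [szL [_ Hpx] HF HS [HU HsS]]]]].
  exists (x :: R), L, b; split=> //.
    by split; [exact: Hpx Hp | move=> z /= /andP[-> Hz]; apply: Hpx].
  have bx : b != x by apply: contraNneq xs => <-; apply: HsS; rewrite mem_head.
  have xV : x \notin b :: R ++ leg_vertices L by apply: contra xs => /HsS.
  split; first by move: HU xV; rewrite /= !inE !negb_or bx => /andP[-> ->] /andP[_ ->].
  move=> z; rewrite !inE => /or3P[/eqP->|->//|zi].
    by rewrite HsS ?mem_head ?orbT.
  by rewrite HsS ?orbT // inE zi orbT.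
rewrite add1n ltnS; case: n => [|n] le.
  exists [::], [::], x; split=> //=; rewrite ?ax //.
    by split=> // z /andP[->].
  by split=> // z; rewrite !inE => ->.
have [R [L [b [szL [_ Hpx] HF HS [HU HsS]]]]] := IHs n Hs Us le.
exists [::], (([::], x, R) :: L), b.
have xV : x \notin b :: R ++ leg_vertices L by apply: contra xs => /HsS.
have Esp : rcons (leg_spine (([::], x, R) :: L)) b = x :: R ++ rcons (leg_spine L) b.
  by rewrite /leg_spine /= -rcons_cat.
split=> //.
- by rewrite /= szL.
- rewrite Esp; split; first exact: Hpx.
  by move=> z /= /andP[-> Hz]; apply: Hpx.
- by move: HS; rewrite /= ax.
have pU : perm_eq (b :: [::] ++ leg_vertices (([::], x, R) :: L))
                  (x :: b :: R ++ leg_vertices L).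
  by apply/permP => p; rewrite /leg_vertices /= !count_cat; clear; lia.
have UV : uniq (x :: b :: R ++ leg_vertices L) by rewrite cons_uniq xV; exact: HU.
split; first by move: UV; rewrite -(perm_uniq pU).
move=> z; rewrite (perm_mem pU) in_cons => /predU1P[->|/HsS zs].
  exact: mem_head.
exact: mem_behead.
Qed.

Lemma leg_of_longest_path (V : finType) (e : rel V) n :
    irreflexive e -> 0 < #|V| -> (forall x, n < #|[set y | e x y]|) ->
  exists a b (L : leg V),
    [/\ size L = n, legs_to e a b L, e a b & uniq (a :: b :: leg_vertices L)].
Proof.
move=> irr /card_gt0P[v _] hdeg.
pose Q m := [exists t : m.-tuple V, sorted e t && uniq t].
have exQ : exists m, Q m by exists 1; apply/existsP; exists [tuple v].
have boundQ m : Q m -> m <= #|V|.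
  by case/existsP=> t /andP[_ Ut]; rewrite -(size_tuple t) -(card_uniqP Ut) max_card.
case: (ex_maxnP exQ boundQ) => m /existsP[t /andP[St Ut]] maxm.
case/lastP Et: (tval t) => [|s a].
  have : m = 0 by rewrite -(size_tuple t) Et.
  have : Q 1 by apply/existsP; exists [tuple v].
  by move/maxm => + m0; rewrite m0.
rewrite Et in St Ut; have szm : m = (size s).+1 by rewrite -(size_tuple t) Et size_rcons.
have Hs : sorted e s by move: St; rewrite -cats1 => /cat_sorted2[].
have [asn Us] := andP (etrans (esym (rcons_uniq _ _)) Ut).
have nb y : e a y -> y \in s.
  move=> ay; have : y \in rcons s a; last first.
    by rewrite mem_rcons inE => /predU1P[Ey|//]; rewrite Ey irr in ay.
  apply/negPn/negP => yt.
  have : Q m.+1.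
    have szt : size (rcons (rcons s a) y) == m.+1 by rewrite !size_rcons szm.
    apply/existsP; exists (Tuple szt); rewrite /= [uniq _]rcons_uniq yt Ut !andbT.
    case: (s) St => [|z s'] /=; first by rewrite ay.
    by rewrite !rcons_path last_rcons ay andbT.
  by move/maxm; rewrite ltnn.
have lenc : n < count (e a) s.
  apply: leq_trans (hdeg a) _; rewrite -size_filter cardE.
  apply: uniq_leq_size (enum_uniq _) _ => y.
  by rewrite mem_enum inE mem_filter => ay; rewrite ay nb.
have [R [L [b [szL [Hp _] HF HS [HU HsS]]]]] := leg_along_path Hs Us lenc.
exists a, b, L; move: HS => /= /andP[ab HS]; split=> //.
  by rewrite /legs_to HF HS; have [_ ->] := cat_sorted2 Hp.
have sub : subseq (b :: leg_vertices L) (b :: R ++ leg_vertices L).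
  by rewrite /= eqxx; apply: suffix_subseq.
apply/andP; split; last exact: subseq_uniq sub HU.
by apply: contra asn => /(mem_subseq sub)/HsS.
Qed.

(* The last vertex of the leg becomes its target, and the last hit is lost. *)
Lemma leg_trim (V : finType) (e : rel V) a b n (L : leg V) x0 :
    size L = n.+2 -> sorted e (leg_spine L) -> leg_fans e L ->
    last x0 (leg_spine L) = b -> all (e a) (leg_starts L) ->
    uniq (leg_vertices L) ->
  exists L', [/\ size L' = n.+1, legs_to e a b L', uniq (b :: leg_vertices L')
               & {subset b :: leg_vertices L' <= leg_vertices L}].
Proof.
case/lastP: L => // L [[Q y] R]; rewrite size_rcons => -[].
case/lastP: L => // L [[Q1 y1] R1]; rewrite size_rcons => -[szL].
(* The segment [y :: R] of the lost hit, without its last vertex, is absorbed by the preceding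
   hit. *)
have ES : leg_spine (rcons (rcons L (Q1, y1, R1)) (Q, y, R))
    = rcons (leg_spine (rcons L (Q1, y1, R1 ++ belast y R))) (last y R).
  rewrite /leg_spine !map_rcons !flatten_rcons /= -!cats1 -!catA /=.
  by rewrite -catA cats1 -lastI.
rewrite ES last_rcons => Hsp + <- + HU.
rewrite /leg_fans /leg_starts !map_rcons !all_rcons /=.
move=> /and3P[_ HF1 HF] /and3P[_ HS1 HS].
exists (rcons L (Q1, y1, R1 ++ belast y R)).
have sub : subseq
    (rcons (leg_vertices (rcons L (Q1, y1, R1 ++ belast y R))) (last y R))
    (leg_vertices (rcons (rcons L (Q1, y1, R1)) (Q, y, R))).
  rewrite /leg_vertices !map_rcons !flatten_rcons /= -!cats1 -!catA /=.
  rewrite -!catA /= cats1 -lastI; apply: cat_subseq => //.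
  apply: cat_subseq => //=; rewrite eqxx; apply: cat_subseq => //.
  exact: suffix_subseq.
split.
- by rewrite size_rcons szL.
- by rewrite /legs_to Hsp /leg_fans /leg_starts !map_rcons !all_rcons /= HF1 HF HS1.
- by move: (subseq_uniq sub HU); rewrite rcons_uniq.
by move=> x xin; apply: (mem_subseq sub); rewrite mem_rcons.
Qed.

Theorem corollary1p17 (k1 k2 : nat) (hk1 : 0 < k1) (hk2 : 0 < k2)
    (hk : ~ (k1 = 1 /\ k2 = 1)) :
  k1 + k2 - 1 = #|vertex (Hstar k1 k2 hk1)| - 1 /\
  (forall D : digraph,
     (forall x : D, k1 + k2 - 1 <= outdeg x) ->
     contains_subdivision D (Hstar k1 k2 hk1)).
Proof.
split=> [|D hdeg]; first by rewrite card_ord.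
have D_irr := @arc_irr D; have D_gt0 := vertex_gt0 D.
have [k12 | k12] := boolP ((k1 == 1) || (k2 == 1)).
  (* One of [k1.-1] and [k2.-1] is 0, so [k1 + k2 - 2] is the size of the other leg. *)
  have [||a [b [L [szL HL ab UL]]]] := @leg_of_longest_path D arc (k1 + k2 - 2) D_irr.
  - by [].
  - by move=> x; apply: leq_trans (hdeg x); lia.
  case/orP: k12 => /eqP E.
    by apply: (@Hstar_of_legs k1 k2 hk1 D a b [::] L) => //=; lia.
  apply: (@Hstar_of_legs k1 k2 hk1 D a b L [::]) => //=; try lia.
  by rewrite cats0.
rewrite negb_or in k12; have [k1n1 k2n1] := andP k12.
have i_gt0 : 0 < k1.-1 by lia.
(* The second colour is asked for [k2] hits rather than [k2.-1], since one is lost when its root [g]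
   becomes [b]. *)
have hdeg' (x : D) : k1.-1 + k2 <= #|[set y | arc x y]|.
  by apply: leq_trans (hdeg x); lia.
have [c [g [cg [sc [sg [T [a [Hcol aT ia ja]]]]]]]] :=
  exists_apex D_irr i_gt0 hk2 D_gt0 hdeg'.
have := col_uniq Hcol; rewrite cat_uniq => /and3P[Uc Ucg Ug].
have [[sc' Ec] [sg' Eg]] := (col_rootc Hcol, col_rootg Hcol).
have := col_out Hcol aT; rewrite mem_cat negb_or => /andP[ac ag].
have i_bound : 0 < k1.-1 <= k1.-1 by rewrite i_gt0 /=.
have j_bound : 0 < k2 <= k2 by rewrite hk2 /=.
have [L1 [sz1 [sp1 fan1] last1 U1 [sub1 st1]]] :=
  caterpillar Uc (col_greedyc Hcol) aT i_bound ia.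
have [L2 [sz2 [sp2 fan2] last2 U2 [sub2 st2]]] :=
  caterpillar Ug (col_greedyg Hcol) aT j_bound ja.
have sz2' : size L2 = k2.-2.+2 by rewrite sz2; move: k2n1 hk2; clear; lia.
rewrite Ec last_rcons in last1; rewrite Eg last_rcons in last2.
have [L [szL HL UL subL]] := leg_trim sz2' sp2 fan2 last2 st2 U2.
have cL x : x \in leg_vertices L1 -> x \notin g :: leg_vertices L.
  move=> /sub1 xc; apply/negP => /subL/sub2 xg.
  by move/hasPn/(_ x xg): Ucg; rewrite /= xc.
apply: (@Hstar_of_legs k1 k2 hk1 D a g L1 L) => //.
- by rewrite szL; move: k2n1 hk2; clear; lia.
(* The spine of [L1] ends in [c], and the arc from [c] to [g] completes it. *)
- rewrite /legs_to fan1 st1 !andbT.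
  by case: (leg_spine L1) sp1 last1 => //= x s; rewrite rcons_path => -> ->.
- have pU : perm_eq (g :: leg_vertices L1 ++ leg_vertices L)
                    (leg_vertices L1 ++ g :: leg_vertices L).
    by apply/permP => p; rewrite /= !count_cat /=; clear; lia.
  rewrite cons_uniq (perm_uniq pU) cat_uniq U1 UL andbT (perm_mem pU).
  rewrite mem_cat negb_or; apply/andP; split; last first.
    by apply/hasPn => x; apply: contraL => /cL.
  rewrite (contra (sub1 a) ac) /=; apply: contra ag; exact: (sub2 a \o subL a).
by case=> E; rewrite E eqxx in k1n1 k2n1.
Qed.
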